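(* Let $x_1,\ldots,x_m\in\mathbb{R}^n$ be nonzero vectors spanning $\mathbb{R}^n$ and $X=[x_1,\ldots,x_m]$. The coordinate descent (CD) algorithm applied to the problem: minimize $h(u)=-\ln\det(XUX^T)+n(e^Tu-1)$ subject to $u\ge0$, $u\in\mathbb{R}^m$, $U=\mathrm{diag}(u)$, is locally linearly convergent, in the following sense: there exist constants $P$ and $Q$ depending only on the data (the points $X$ and the initial point) such that for every $\epsilon\in(0,1)$ the number of iterations of the CD algorithm required to obtain an $\epsilon$-approximately optimal $u$ is at most $P+Q\log_2(1/\epsilon)$.
   Context: $e$ is the all-ones vector, $e_i$ the $i$-th standard basis vector of $\mathbb{R}^m$; $\kappa(u)_i=x_i^T(XUX^T)^{-1}x_i$. For $u\ge0$ with $XUX^T$ positive definite: $u$ is $\epsilon$-approximately optimal if $\kappa(u)_i\le(1+\epsilon)n$ for all $i$ and $\kappa(u)_i\ge(1-\epsilon)n$ whenever $u_i>0$. Initial points: Khachiyan's scheme takes $u_0=(1/m,\ldots,1/m)$. The Kumar–Yildirim scheme produces $u_0\ge 0$ with $e^Tu_0=1$, having at most $2n$ nonzero coordinates, such that the points $x_i$ with $(u_0)_i>0$ span $\mathbb{R}^n$, and with $\kappa(u_0)_i\le n^5\cdot n$ for all $i$. The CD algorithm is started from one of these. CD algorithm: given the current iterate $u$ (with $XUX^T$ positive definite), let $j_+\in\arg\max_i\kappa(u)_i$, $\kappa_+=\kappa(u)_{j_+}$, $j_-\in\arg\min_{i:u_i>0}\kappa(u)_i$, $\kappa_-=\kappa(u)_{j_-}$.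 If $\kappa_+-n\ge n-\kappa_-$, coordinate $j_+$ is chosen and the next iterate is $u^\dagger=u+\frac{\kappa_+-n}{\kappa_+^2}e_{j_+}$. Otherwise coordinate $j_-$ is chosen and $u^\dagger$ is obtained from $u$ by replacing $u_{j_-}$ by $\max\{u_{j_-}-\frac{n-\kappa_-}{n\kappa_-},0\}$. *)

(* Defs.v *)
From mathcomp Require Import all_boot all_order all_algebra.
From mathcomp Require Import reals exp.

Set Implicit Arguments.
Unset Strict Implicit.
Unset Printing Implicit Defensive.

Import Order.TTheory GRing.Theory Num.Theory.
Local Open Scope ring_scope.

Definition log2 (R : realType) (x : R) : R := ln x / ln 2.

Definition posdefmx (R : realType) (n : nat) (A : 'M[R]_n) : Prop :=
  A^T = A /\ forall v : 'cV[R]_n, v != 0 -> 0 < (v^T *m A *m v) 0 0.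

(* The points x_1, ..., x_m are the columns of X.  The row-space operations of
   %MS are applied to the transposed points. *)
Definition points_span (R : realType) (n m : nat) (X : 'M[R]_(n, m))
    (P : pred 'I_m) : bool :=
  row_full (\sum_(i | P i) <<(col i X)^T>>)%MS.

(* X U X^T with U = diag(u). *)
Definition gram (R : realType) (n m : nat) (X : 'M[R]_(n, m)) (u : 'rV[R]_m) :
    'M[R]_n :=
  X *m diag_mx u *m X^T.

(* For h(u) = - ln det (X U X^T) + n (e^T u - 1), the i-th partial derivative
   of h at u is n - kappa X u i.  If gram X u is singular, invmx returns its
   argument unchanged and the value is meaningless. *)
Definition kappa (R : realType) (n m : nat) (X : 'M[R]_(n, m)) (u : 'rV[R]_m)
    (i : 'I_m) : R :=
  ((col i X)^T *m invmx (gram X u) *m col i X) 0 0.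

Definition approx_optimal (R : realType) (n m : nat) (X : 'M[R]_(n, m))
    (eps : R) (u : 'rV[R]_m) : Prop :=
  [/\ forall i, 0 <= u 0 i,
      posdefmx (gram X u),
      forall i, kappa X u i <= (1 + eps) * n%:R &
      forall i, 0 < u 0 i -> (1 - eps) * n%:R <= kappa X u i].

Definition khachiyan_init (R : realType) (m : nat) (u : 'rV[R]_m) : Prop :=
  u = const_mx m%:R^-1.

(* The guarantees of the Kumar-Yildirim scheme; every point satisfying them is
   admitted as its output. *)
Definition kumar_yildirim_init (R : realType) (n m : nat) (X : 'M[R]_(n, m))
    (u : 'rV[R]_m) : Prop :=
  [/\ forall i, 0 <= u 0 i,
      \sum_i u 0 i = 1,
      (#|[pred i | (u 0 i != 0)%R]| <= 2 * n)%N,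
      points_span X (fun i => 0 < u 0 i) &
      forall i, kappa X u i <= n%:R ^+ 5 * n%:R].

(* A relation rather than a function: ties in the arg max and the arg min may
   be broken arbitrarily.  Positive definiteness of gram X u is not required
   here; it holds at the initial points and is preserved by every step. *)
Definition cd_step (R : realType) (n m : nat) (X : 'M[R]_(n, m))
    (u u' : 'rV[R]_m) : Prop :=
  exists jp jm : 'I_m,
    let kp := kappa X u jp in
    let km := kappa X u jm in
    [/\ forall i, kappa X u i <= kp,
        0 < u 0 jm,
        forall i, 0 < u 0 i -> km <= kappa X u i &
        u' = if n%:R - km <= kp - n%:R
             then u + ((kp - n%:R) / kp ^+ 2) *: delta_mx 0 jp
             else \row_i (if i == jm
                          then Num.max (u 0 i - (n%:R - km) / (n%:R * km)) 0
                          else u 0 i)].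

Definition cd_run (R : realType) (n m : nat) (X : 'M[R]_(n, m))
    (u0 : 'rV[R]_m) (u : nat -> 'rV[R]_m) : Prop :=
  u 0%N = u0 /\ forall k, cd_step X (u k) (u k.+1).

(* Main.v *)
Require Import Defs.
From mathcomp Require Import all_boot all_order all_algebra.
From mathcomp Require Import perm boolp classical_sets reals topology normedtype.
From mathcomp Require Import sequences derive exp.
From mathcomp Require Import ring lra.

(** The objective [h(u) = - ln det G(u) + n (e^T u - 1)], with [G(u)] the Gram
    matrix, is convex and has the partial derivatives [n - kappa_i].  Let [eta]
    be the largest violation of the optimality conditions at [u], that is, the
    maximum of [kappa_+ - n] and [n - kappa_-].  Linear convergence rests on two
    estimates that are quadratic in [eta] and hold on the level set of the
    initial point.

    Every step decreases [h] by at least [c eta^2], unless it is cut short by the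
    constraint [u >= 0], in which case [h] does not increase ([cd_step_progress]).
    This is a computation in one variable, since a coordinate step multiplies
    the determinant by an explicit factor; [c] depends on an upper bound for the
    [kappa_i] on the level set ([kappa_bounded]).

    Conversely, the gap between [h(u)] and the minimum is at most [C eta^2]
    ([error_bound]).  The function [h] is not strongly convex in [u], and it can
    have many minimizers, but it is strongly convex as a function of [G(u)]
    ([gram_dist_le]), and the minimizers form a polyhedron: they are determined
    by their Gram matrix and one linear equation.  Hoffman's bound
    ([hoffman_bound]) converts closeness of Gram matrices into closeness to
    this polyhedron, as in the method of Luo and Tseng.

    Together, each uncut step multiplies the gap by at most [exp (- c / C)], and
    as long as [eta] exceeds [eps] the gap before such a step is at least
    [c eps^2].  So the number of uncut steps is logarithmic in [1 / eps].  A cut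
    step empties a coordinate of [u] and an uncut one fills at most one, so the
    cut steps outnumber the uncut ones by at most the size of the initial
    support ([count_productive]). *)

Set Implicit Arguments.
Unset Strict Implicit.
Unset Printing Implicit Defensive.

Import Order.TTheory GRing.Theory Num.Theory.
Import numFieldNormedType.Exports.
Local Open Scope ring_scope.

(** * Determinants and positive definite matrices *)

(** Both sides are the determinant of the block matrix with rows (1, -r) and
    (c, 1), computed by eliminating in the two possible orders. *)
Lemma det_1D_mul_col_row (R : comNzRingType) n (c : 'cV[R]_n) (r : 'rV[R]_n) :
  \det (1%:M + c *m r) = 1 + (r *m c) 0 0.
Proof.
have H : block_mx 1%:M 0 c 1%:M *m block_mx 1%:M (- r) 0 (1%:M + c *m r)
  = block_mx (1%:M + r *m c) (- r) 0 1%:M *m block_mx 1%:M 0 c 1%:M :> 'M_(1 + n).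
  rewrite !mulmx_block !mul1mx !mulmx1 !mul0mx !mulmx0 !addr0 ?add0r.
  by congr block_mx; rewrite ?mulNmx ?mulmxN ?addrK // addrC addrK.
move/(congr1 determinant): H.
rewrite !det_mulmx !det_ublock !det_lblock !det1 !mul1r !mulr1 => ->.
by rewrite det_mx11 !mxE.
Qed.

(** A coordinate step changes the Gram matrix by a rank-one term, so this
    formula gives the exact change of the objective along a coordinate. *)
Lemma det_rank1_update (R : fieldType) n (A : 'M[R]_n) (c : 'cV[R]_n)
    (r : 'rV[R]_n) :
  A \in unitmx ->
  \det (A + c *m r) = \det A * (1 + (r *m invmx A *m c) 0 0).
Proof.
move=> uA; have -> : A + c *m r = A *m (1%:M + (invmx A *m c) *m r).
  by rewrite mulmxDr mulmx1 -!mulmxA mulKVmx.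
by rewrite det_mulmx det_1D_mul_col_row mulmxA.
Qed.

Section Posdef.
Variable R : realType.

Lemma posdef_congr n (A S : 'M[R]_n) :
  S \in unitmx -> posdefmx A -> posdefmx (S *m A *m S^T).
Proof.
move=> uS [Asym Apos]; split=> [|v v0].
  by rewrite !trmx_mul trmxK Asym mulmxA.
have -> : v^T *m (S *m A *m S^T) *m v = (S^T *m v)^T *m A *m (S^T *m v).
  by rewrite trmx_mul trmxK !mulmxA.
apply: Apos; apply: contra_neq v0 => /(congr1 (mulmx (invmx S^T))).
by rewrite mulKmx ?unitmx_tr // mulmx0.
Qed.

Lemma posdef_unitmx n (A : 'M[R]_n) : posdefmx A -> A \in unitmx.
Proof.
move=> [Asym Apos]; rewrite -row_free_unit -kermx_eq0; apply/eqP/row_matrixP => i.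
rewrite row0; apply/eqP; apply: contraT => r0.
have := Apos (row i (kermx A))^T; rewrite trmxK trmx_eq0 => /(_ r0).
by rewrite -row_mul mulmx_ker row0 mul0mx mxE ltxx.
Qed.

(** One step of symmetric elimination.  Clearing the first row and column with
    the pivot [a] replaces the remaining block by its Schur complement, which
    subtracts squares from the diagonal; hence the trace does not grow.  The
    triangular factorization and the determinant bound below are inductions on
    this step. *)
Lemma posdef_schur n (A : 'M[R]_(1 + n)) : posdefmx A ->
  exists (T : 'M[R]_(1 + n)) (a : R) (C : 'M[R]_n),
    [/\ \det T = 1, 0 < a, posdefmx C,
        T *m A *m T^T = block_mx a%:M 0 0 C & a + \tr C <= \tr A].
Proof.
move=> PA; have [Asym Apos] := PA.
pose a := A 0 0; pose b : 'rV_n := ursubmx A; pose C := drsubmx A.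
have eA : A = block_mx a%:M b b^T C.
  rewrite -[LHS]submxK; congr block_mx.
    apply/matrixP=> i j; rewrite !ord1 !mxE eqxx mulr1n.
    by congr (A _ _); apply/val_inj.
  by rewrite /b -{1}Asym; apply/matrixP=> i j; rewrite !mxE.
have a0 : 0 < a.
  have := Apos (delta_mx 0 0); rewrite trmx_delta -rowE -colE !mxE; apply.
  by apply/negP => /eqP/matrixP/(_ 0 0)/eqP; rewrite !mxE !eqxx oner_eq0.
have an0 : a != 0 by rewrite gt_eqF.
pose c : 'rV_n := - a^-1 *: b.
pose T : 'M[R]_(1 + n) := block_mx 1%:M 0 c^T 1%:M.
have dT : \det T = 1 by rewrite det_lblock !det1 mulr1.
have uT : T \in unitmx by rewrite unitmxE dT unitr1.
pose C' := C - a^-1 *: (b^T *m b).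
have eT : T *m A *m T^T = block_mx a%:M 0 0 C'.
  rewrite eA /T tr_block_mx !trmx1 !trmx0 !mulmx_block.
  rewrite !(mul1mx, mulmx1, mul0mx, mulmx0, addr0) trmxK.
  have e1 : a%:M *m c + b = 0.
    by rewrite mul_scalar_mx scalerA mulrN mulfV // scaleN1r addNr.
  have e2 : c^T *m a%:M + b^T = 0.
    have := congr1 trmx e1; rewrite linearD /= trmx_mul tr_scalar_mx => ->.
    exact: trmx0.
  rewrite e1 e2 mul0mx add0r.
  by congr block_mx; rewrite /C' addrC /c linearZ /= -scalemxAl scaleNr.
have := posdef_congr uT PA; rewrite eT => -[Bsym Bpos].
exists T, a, C'; split=> //.
  split.
    move: Bsym; rewrite tr_block_mx => /(congr1 drsubmx).
    by rewrite !block_mxKdr.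
  move=> v v0; have := Bpos (col_mx 0 v).
  rewrite tr_col_mx mul_row_block trmx0 !mul0mx !mulmx0 !add0r mul_row_col.
  rewrite mulmx0 add0r; apply; apply: contra_neq v0 => /(congr1 dsubmx).
  by rewrite col_mxKd linear0.
rewrite [X in _ <= \tr X]eA mxtrace_block.
have -> : \tr (a%:M : 'M_1) = a by rewrite mxtrace_scalar.
rewrite lerD2l /C' raddfB /= gerBl linearZ /= mulr_ge0 ?invr_ge0 ?(ltW a0) //.
by apply: sumr_ge0 => i _; rewrite mxE big_ord1 mxE -expr2 sqr_ge0.
Qed.

Lemma posdef_cholesky n (A : 'M[R]_n) : posdefmx A ->
  exists S : 'M[R]_n, S *m A *m S^T = 1%:M.
Proof.
elim: n A => [|n IH] A PA; first by exists 0; rewrite [LHS]flatmx0 [RHS]flatmx0.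
have [T [a [C [_ a0 /IH[S eS] eT _]]]] := posdef_schur PA.
pose s := Num.sqrt a.
have s0 : s != 0 by rewrite sqrtr_eq0 -ltNge.
pose B : 'M[R]_(1 + n) := block_mx (s^-1)%:M 0 0 S.
exists (B *m T).
have -> : B *m T *m A *m (B *m T)^T = B *m (T *m A *m T^T) *m B^T.
  by rewrite trmx_mul !mulmxA.
rewrite eT /B tr_block_mx tr_scalar_mx !trmx0 !mulmx_block.
rewrite ?(mul0mx, mulmx0) !addr0 !add0r ?(mul0mx, mulmx0) eS.
transitivity (block_mx 1%:M 0 0 1%:M : 'M[R]_(1 + n)); last first.
  by rewrite -scalar_mx_block.
rewrite -!scalar_mxM; have -> // : s^-1 * a * s^-1 = 1.
by rewrite -(sqr_sqrtr (ltW a0)) -/s; field.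
Qed.

Lemma posdef_det_gt0 n (A : 'M[R]_n) : posdefmx A -> 0 < \det A.
Proof.
move=> /posdef_cholesky[S /(congr1 determinant)].
rewrite !det_mulmx det_tr det1 => e.
have s0 : \det S != 0.
  by apply/eqP => s0; move: e; rewrite s0 !mul0r => /eqP; rewrite eq_sym oner_eq0.
rewrite -(pmulr_lgt0 _ (_ : 0 < \det S ^+ 2)) ?exprn_even_gt0 //.
by rewrite expr2 mulrA (mulrC (\det A)) e ltr01.
Qed.

(** The arithmetic-geometric mean inequality for the eigenvalues, proved without
    them: the determinant is the product of the pivots of elimination, each
    pivot [a] is at most [expR (a - 1)], and the pivots sum to at most the
    trace. *)
Lemma posdef_det_le n (A : 'M[R]_n) : posdefmx A ->
  \det A <= expR (\tr A - n%:R).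
Proof.
elim: n A => [|n IH] A PA.
  by rewrite det_mx00 /mxtrace big_ord0 subr0 expR0.
have [T [a [C [dT a0 PC eT trA]]]] := posdef_schur PA.
have -> : \det A = a * \det C.
  have := congr1 determinant eT; rewrite !det_mulmx det_tr dT mulr1 mul1r => ->.
  by rewrite (@det_lblock _ 1 n) det_scalar1.
have ha : a <= expR (a - 1) by rewrite (le_trans _ (expR_ge1Dx _)) // addrC subrK.
apply: (@le_trans _ _ (expR (a - 1) * expR (\tr C - n%:R))).
  by rewrite ler_pM ?(ltW a0) ?(ltW (posdef_det_gt0 PC)) ?IH.
rewrite -expRD ler_expR -natr1; lra.
Qed.

(** Concavity of the logarithm of the determinant, as a tangent inequality at
    [A].  A congruence that turns [A] into the identity reduces it to
    [posdef_det_le]. *)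
Lemma ln_det_concave n (A B : 'M[R]_n) : posdefmx A -> posdefmx B ->
  ln (\det B) - ln (\det A) <= \tr (invmx A *m B) - n%:R.
Proof.
move=> PA PB; have [S eS] := posdef_cholesky PA.
have [dA dB] := (posdef_det_gt0 PA, posdef_det_gt0 PB).
have uS : S \in unitmx.
  have : S *m (A *m S^T) = 1%:M by rewrite mulmxA.
  by case/mulmx1_unit.
have eA : invmx A = S^T *m S.
  have : (A *m S^T) *m S = 1%:M by apply: mulmx1C; rewrite mulmxA.
  rewrite -mulmxA => /(congr1 (mulmx (invmx A))).
  by rewrite mulKmx ?posdef_unitmx // mulmx1.
have PN := posdef_congr uS PB.
have := posdef_det_le PN.
rewrite !det_mulmx det_tr mxtrace_mulC mulmxA -eA.
have -> : \det S * \det B * \det S = \det B / \det A.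
  have := congr1 determinant eS; rewrite !det_mulmx det_tr det1 => e.
  have := gt_eqF dA => /negbT dA0.
  by apply: (mulIf dA0); rewrite divfK // -(mulr1 (\det B)) -[in RHS]e; ring.
rewrite -ler_ln ?posrE ?expR_gt0 ?divr_gt0 // expRK ln_div ?posrE //.
Qed.

End Posdef.

(** Weights may vanish, so the inequality is read off from the nonnegative
    quantity [\sum_i p i * (s * y i - t * z i) ^+ 2] when [s] is positive, and
    every term vanishes when [s] is zero. *)
Lemma weighted_cauchy_schwarz (R : realFieldType) (I : finType) (p y z : I -> R) :
  (forall i, 0 <= p i) ->
  (\sum_i p i * (y i * z i)) ^+ 2 <=
  (\sum_i p i * z i ^+ 2) * \sum_i p i * y i ^+ 2.
Proof.
move=> p0; set s := \sum_i p i * z i ^+ 2; set Y := \sum_i p i * y i ^+ 2.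
set t := \sum_i p i * (y i * z i).
have s0 : 0 <= s by apply: sumr_ge0 => i _; rewrite mulr_ge0 ?sqr_ge0.
have [s_eq0|s_neq0] := eqVneq s 0.
  have pz i : p i * z i = 0.
    have pz2 j : true -> 0 <= p j * z j ^+ 2 by rewrite mulr_ge0 ?sqr_ge0.
    have /(_ i isT)/eqP := psumr_eq0P pz2 s_eq0.
    by rewrite mulf_eq0 sqrf_eq0 -mulf_eq0 => /eqP.
  have -> : t = 0 by apply: big1 => i _; rewrite mulrCA pz mulr0.
  by rewrite s_eq0 expr0n mul0r.
have {s_neq0}s_gt0 : 0 < s by rewrite lt_def s_neq0.
have : 0 <= \sum_i p i * (s * y i - t * z i) ^+ 2.
  by apply: sumr_ge0 => i _; rewrite mulr_ge0 ?sqr_ge0.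
have expand a b : \sum_i p i * (a * y i - b * z i) ^+ 2 =
    a ^+ 2 * Y - 2 * a * b * t + b ^+ 2 * s.
  rewrite !mulr_sumr -sumrB -big_split /=; apply: eq_bigr => i _; ring.
rewrite expand (_ : _ + _ = s * (s * Y - t ^+ 2)); last by ring.
by rewrite pmulr_rge0 // subr_ge0.
Qed.

Lemma mulmx_invB (R : fieldType) n (A B : 'M[R]_n) :
  A \in unitmx -> B \in unitmx -> A *m (invmx B - invmx A) *m B = A - B.
Proof.
by move=> uA uB; rewrite mulmxBr mulmxBl mulmxKV // mulmxV // mul1mx.
Qed.

(** * The Gram matrix and the objective *)

Section Gram.
Variables (R : realType) (n m : nat) (X : 'M[R]_(n, m)).
Implicit Types u v w : 'rV[R]_m.

Definition feasible u := (forall i, 0 <= u 0 i) /\ posdefmx (gram X u).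

Definition objective u : R :=
  - ln (\det (gram X u)) + n%:R * (\sum_i u 0 i - 1).

Lemma gramE u a b : gram X u a b = \sum_i u 0 i * (X a i * X b i).
Proof.
by rewrite /gram mul_mx_diag !mxE; apply: eq_bigr => i _; rewrite !mxE; ring.
Qed.

Lemma gramD u v : gram X (u + v) = gram X u + gram X v.
Proof. by rewrite /gram linearD /= mulmxDr mulmxDl. Qed.

Lemma gramZ c u : gram X (c *: u) = c *: gram X u.
Proof. by rewrite /gram linearZ /= -scalemxAr -scalemxAl. Qed.

Lemma gram_delta j : gram X (delta_mx 0 j) = col j X *m (col j X)^T.
Proof.
apply/matrixP=> a b; rewrite gramE (bigD1 j) //= big1 ?addr0 => [|i ij].
  by rewrite mxE !mxE !eqxx mul1r big_ord1 !mxE.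
by rewrite !mxE eqxx (negPf ij) mul0r.
Qed.

Lemma tr_gram u : (gram X u)^T = gram X u.
Proof. by rewrite /gram !trmx_mul tr_diag_mx trmxK mulmxA. Qed.

Lemma gram_quad u (v : 'cV[R]_n) :
  (v^T *m gram X u *m v) 0 0 = \sum_i u 0 i * (X^T *m v) i 0 ^+ 2.
Proof.
have -> : v^T *m gram X u *m v = (X^T *m v)^T *m diag_mx u *m (X^T *m v).
  by rewrite /gram trmx_mul trmxK !mulmxA.
rewrite mul_mx_diag [LHS]mxE; apply: eq_bigr => i _.
by rewrite 2!mxE; ring.
Qed.

Lemma posdef_gram u : (forall i, 0 <= u 0 i) ->
  (forall v : 'cV[R]_n, (forall i, 0 < u 0 i -> (X^T *m v) i 0 = 0) -> v = 0) ->
  posdefmx (gram X u).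
Proof.
move=> u0 inj; split=> [|v]; first exact: tr_gram.
apply: contra_neqT; rewrite -leNgt gram_quad => le0; apply: inj => i ui.
have pos j : true -> 0 <= u 0 j * (X^T *m v) j 0 ^+ 2.
  by rewrite mulr_ge0 ?sqr_ge0.
have /psumr_eq0P : \sum_i u 0 i * (X^T *m v) i 0 ^+ 2 = 0.
  by apply/eqP; rewrite eq_le le0 sumr_ge0.
by move=> /(_ pos i isT)/eqP; rewrite mulf_eq0 gt_eqF //= sqrf_eq0 => /eqP.
Qed.

(** A Gram matrix of nonnegative weights is always positive semidefinite, so
    that only its determinant has to be followed along the algorithm. *)
Lemma feasible_det u : (forall i, 0 <= u 0 i) -> 0 < \det (gram X u) ->
  feasible u.
Proof.
move=> u0 du; split=> //; apply: posdef_gram => // v Hv.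
have ug : gram X u \in unitmx by rewrite unitmxE unitfE gt_eqF.
rewrite -(mulKmx ug v) (_ : gram X u *m v = 0) ?mulmx0 //.
rewrite /gram -!mulmxA mul_diag_mx.
rewrite (_ : (\matrix_(_, _) _) = 0) ?mulmx0 //; apply/matrixP=> i j.
rewrite !mxE; have := u0 i; rewrite le_eqVlt => /predU1P[<-|ui].
  by rewrite mul0r.
by have := Hv i ui; rewrite !ord1 mxE => ->; rewrite mulr0.
Qed.

Lemma span_posdef u : (forall i, 0 <= u 0 i) ->
  points_span X (fun i => 0 < u 0 i) -> posdefmx (gram X u).
Proof.
move=> u0 span; apply: posdef_gram => // v Hv.
rewrite /points_span in span; set W := (X in row_full X) in span.
have /sub_kermxP Wv : (W <= kermx v)%MS.
  apply/sumsmx_subP => i ui; rewrite genmxE; apply/sub_kermxP.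
  have := Hv i ui; rewrite tr_col -row_mul => e.
  by apply/matrixP=> a b; rewrite !ord1 mxE e mxE.
have /row_fullP[B BW] := span.
by rewrite -(mul1mx v) -BW -mulmxA Wv mulmx0.
Qed.

Lemma trace_mul_gram (A : 'M[R]_n) u :
  \tr (A *m gram X u) = \sum_i u 0 i * ((col i X)^T *m A *m col i X) 0 0.
Proof.
have -> : gram X u = \sum_i u 0 i *: (col i X *m (col i X)^T).
  apply/matrixP=> a b; rewrite gramE summxE; apply: eq_bigr => i _.
  by rewrite !mxE big_ord1 !mxE.
rewrite mulmx_sumr raddf_sum /=; apply: eq_bigr => i _.
rewrite -scalemxAr linearZ /= mulmxA mxtrace_mulC mulmxA.
by rewrite /mxtrace big_ord1.
Qed.

Lemma trace_kappa u v :
  \tr (invmx (gram X u) *m gram X v) = \sum_i v 0 i * kappa X u i.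
Proof. exact: trace_mul_gram. Qed.

Lemma sum_kappa u : posdefmx (gram X u) -> \sum_i u 0 i * kappa X u i = n%:R.
Proof. by move=> P; rewrite -trace_kappa mulVmx ?posdef_unitmx // mxtrace1. Qed.

Lemma kappa_gt0 u i : posdefmx (gram X u) -> col i X != 0 -> 0 < kappa X u i.
Proof.
move=> P xi; have uP := posdef_unitmx P.
pose y := invmx (gram X u) *m col i X.
rewrite /kappa (_ : _ *m _ = y^T *m gram X u *m y).
  apply: P.2.
  apply: contra_neq xi => /(congr1 (mulmx (gram X u))).
  by rewrite mulKVmx // mulmx0.
by rewrite -[RHS]mulmxA mulKVmx // trmx_mul trmx_inv tr_gram.
Qed.

Lemma det_gram_step u j c : posdefmx (gram X u) ->
  \det (gram X (u + c *: delta_mx 0 j)) = \det (gram X u) * (1 + c * kappa X u j).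
Proof.
move=> P; rewrite gramD gramZ gram_delta scalemxAl det_rank1_update ?posdef_unitmx //.
by rewrite -scalemxAr mxE.
Qed.

Lemma sum_step u j (c : R) :
  \sum_i (u + c *: delta_mx 0 j) 0 i = \sum_i u 0 i + c.
Proof.
under eq_bigr => i _ do rewrite !mxE eqxx /=.
rewrite big_split /=; congr (_ + _); rewrite (bigD1 j) //= eqxx mulr1.
by rewrite big1 ?addr0 // => i /negPf->; rewrite mulr0.
Qed.

Lemma objective_step u j c : posdefmx (gram X u) -> 0 < 1 + c * kappa X u j ->
  objective (u + c *: delta_mx 0 j) =
  objective u - ln (1 + c * kappa X u j) + n%:R * c.
Proof.
move=> P c0; rewrite /objective det_gram_step // sum_step lnM ?posrE //.
  by ring.
exact: posdef_det_gt0.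
Qed.

(** Convexity of the objective: the right-hand side is its gradient at [u]
    paired with [u - w]. *)
Lemma objective_gradient u w : posdefmx (gram X u) -> posdefmx (gram X w) ->
  objective u - objective w <= \sum_i (n%:R - kappa X u i) * (u 0 i - w 0 i).
Proof.
move=> Pu Pw; have := ln_det_concave Pu Pw; rewrite trace_kappa => H.
have -> : \sum_i (n%:R - kappa X u i) * (u 0 i - w 0 i) =
   n%:R * (\sum_i u 0 i) - n%:R * (\sum_i w 0 i)
   - \sum_i u 0 i * kappa X u i + \sum_i w 0 i * kappa X u i.
  rewrite !mulr_sumr -!sumrB -big_split /=.
  by apply: eq_bigr => i _; ring.
rewrite sum_kappa // /objective; lra.
Qed.

(** Strong monotonicity of the gradient, measured on Gram matrices.  Write
    [G] and [H] for the Gram matrices of [u] and [w], [D] for [G - H] and [E]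
    for [H^-1 - G^-1].  Then [D = G E H], which expands every entry of [D] as a
    combination of the numbers [x_i^T E x_j] with weights [u_i w_j].  The pairing
    of gradients is the trace of [E D], and by the same expansion it is the sum
    of [u_i w_j (x_i^T E x_j)^2].  Cauchy-Schwarz compares the two, without any
    bound on eigenvalues. *)
Lemma gram_dist_le u w a b : feasible u -> feasible w ->
  (gram X u - gram X w) a b ^+ 2 <=
  (\sum_i u 0 i * X a i ^+ 2) * (\sum_j w 0 j * X b j ^+ 2) *
  \sum_i (kappa X w i - kappa X u i) * (u 0 i - w 0 i).
Proof.
move=> [u0 Pu] [w0 Pw].
have [uu uw] := (posdef_unitmx Pu, posdef_unitmx Pw).
set D := gram X u - gram X w.
pose E := invmx (gram X w) - invmx (gram X u).
pose Y := X^T *m E *m X.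
have eD : D = gram X u *m E *m gram X w by rewrite mulmx_invB.
have Dsym : D^T = D by rewrite /D linearB /= !tr_gram.
pose q (k : 'I_m * 'I_m) := u 0 k.1 * w 0 k.2.
(* The pairing is the trace of E D.  Writing D, which is symmetric, as
   gram X w E^T gram X u makes it a Gram quadratic form for u, whose terms are
   Gram quadratic forms for w. *)
have eT : \sum_i (kappa X w i - kappa X u i) * (u 0 i - w 0 i) =
    \sum_k q k * Y k.1 k.2 ^+ 2.
  transitivity (\tr (E *m D)).
    rewrite /E /D mulmxBl !mulmxBr !raddfB /= !trace_kappa.
    rewrite -!sumrN -!big_split /=; apply: eq_bigr => i _; ring.
  have -> : D = gram X w *m (E^T *m gram X u).
    by rewrite -[LHS]Dsym eD (trmx_mul _ (gram X w)) (trmx_mul (gram X u)) !tr_gram.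
  rewrite -(pair_bigA _ (fun i j => u 0 i * w 0 j * Y i j ^+ 2)) /=.
  rewrite (mulmxA _ E^T) (mulmxA E) trace_mul_gram; apply: eq_bigr => i _.
  under eq_bigr => j _ do rewrite -mulrA.
  rewrite -mulr_sumr; congr (_ * _).
  have -> : (col i X)^T *m (E *m (gram X w *m E^T)) *m col i X =
     (E^T *m col i X)^T *m gram X w *m (E^T *m col i X).
    by rewrite trmx_mul trmxK !mulmxA.
  rewrite gram_quad; apply: eq_bigr => j _; congr (_ * _ ^+ 2).
  have -> : X^T *m (E^T *m col i X) = col i Y^T.
    by rewrite /Y !trmx_mul trmxK !colE !mulmxA.
  by rewrite mxE mxE.
have eDab : D a b = \sum_k q k * (Y k.1 k.2 * (X a k.1 * X b k.2)).
  rewrite -(pair_bigA _ (fun i j => u 0 i * w 0 j * (Y i j * (X a i * X b j)))) /=.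
  have -> : D = X *m diag_mx u *m Y *m diag_mx w *m X^T.
    by rewrite eD /gram /Y !mulmxA.
  rewrite exchange_big /= mxE; apply: eq_bigr => j _.
  rewrite mul_mx_diag !mxE !mulr_suml; apply: eq_bigr => i _.
  by rewrite mul_mx_diag !mxE; ring.
have q0 k : 0 <= q k by rewrite mulr_ge0.
rewrite eDab eT; apply: le_trans (weighted_cauchy_schwarz _ _ q0) _.
apply: ler_wpM2r.
  by apply: sumr_ge0 => k _; rewrite mulr_ge0 ?sqr_ge0.
rewrite -(pair_bigA _ (fun i j => u 0 i * w 0 j * (X a i * X b j) ^+ 2)) /=.
rewrite mulr_suml; apply: ler_sum => i _; rewrite mulr_sumr.
by apply: ler_sum => j _; rewrite le_eqVlt; apply/orP; left; apply/eqP; ring.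
Qed.

End Gram.

(** * Decrease of the objective in one step *)

Section Log.
Variable R : realType.
Implicit Types x y : R.

Lemma ln_ge_1Binv x : 0 < x -> 1 - x^-1 <= ln x.
Proof.
move=> x0; have x1 : -1 < x^-1 - 1 by rewrite ltrBrDr addNr invr_gt0.
have := le_ln1Dx x1; rewrite addrC subrK lnV ?posrE //; lra.
Qed.

(** The inequality [1 - 1/x <= ln x] is tangent at 1 but loses the
    second-order term in [ln x] that a descent estimate needs.  Applied to a
    square root and doubled, it keeps enough of it; both bounds below come from
    this one. *)
Lemma ln_ge_sqrt y : 0 < y -> 2 * (1 - y^-1) <= ln (y ^+ 2).
Proof.
move=> y0; have := ln_ge_1Binv y0; rewrite lnXn // mulr2n; lra.
Qed.

Lemma ln1D_ge x : 0 <= x -> x - x ^+ 2 + x ^+ 2 / 6 <= ln (1 + x).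
Proof.
move=> x0; pose y := Num.sqrt (1 + x).
have ey : y ^+ 2 = 1 + x by rewrite sqr_sqrtr ?addr_ge0.
have y1 : 1 <= y by rewrite -sqrtr1 ler_wsqrtr // lerDl.
have y0 : 0 < y by apply: lt_le_trans y1.
have := ln_ge_sqrt y0; rewrite ey; apply: le_trans.
have -> : x = y ^+ 2 - 1 by rewrite ey; ring.
set z := y^-1; have yz : y * z = 1 by rewrite mulfV // gt_eqF.
have z1 : z <= 1 by rewrite invf_le1.
rewrite -subr_ge0.
have -> : 2 * (1 - z) -
   (y ^+ 2 - 1 - (y ^+ 2 - 1) ^+ 2 + (y ^+ 2 - 1) ^+ 2 / 6) =
   (y - 1) ^+ 2 * (5 / 6 * (y + 1) ^+ 2 - 1 - 2 * z).
  have -> : 2 * (1 - z) = 2 * (y * z) * (1 - z) by rewrite yz; ring.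
  have -> : (y - 1) ^+ 2 * (5 / 6 * (y + 1) ^+ 2 - 1 - 2 * z) =
    (y - 1) ^+ 2 * (5 / 6 * (y + 1) ^+ 2 - 1) - 2 * y * (y * z) + 4 * (y * z)
    - 2 * z by ring.
  have -> : 2 * (y * z) * (1 - z) = 2 * (y * z) - 2 * z * (y * z) by ring.
  by rewrite yz; field.
by rewrite mulr_ge0 ?sqr_ge0 //; nra.
Qed.

Lemma ln_ge x : 0 < x -> x <= 1 -> 1 - x^-1 + (1 - x) ^+ 2 / 4 <= ln x.
Proof.
move=> x0 x1; pose y := Num.sqrt x.
have ey : y ^+ 2 = x by rewrite sqr_sqrtr // ltW.
have y0 : 0 < y by rewrite sqrtr_gt0.
have y1 : y <= 1 by rewrite -sqrtr1 ler_wsqrtr.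
have := ln_ge_sqrt y0; rewrite ey; apply: le_trans.
rewrite -ey -exprVn; set z := y^-1.
have z1 : 1 <= z by rewrite invf_ge1.
have yz : y * z = 1 by rewrite mulfV // gt_eqF.
have -> : 1 - y ^+ 2 = (1 - y) * (1 + y) by ring.
have : (1 - y) * (1 + y) / 2 <= z - 1.
  have -> : z - 1 = z * (1 - y) by rewrite mulrBr mulr1 [z * y]mulrC yz.
  nra.
have : 0 <= (1 - y) * (1 + y) / 2 by nra.
nra.
Qed.

End Log.

Section Step.
Variables (R : realType) (n m : nat) (X : 'M[R]_(n, m)).
Hypothesis n_gt0 : (0 < n)%N.
Hypothesis X_neq0 : forall i, col i X != 0.
Implicit Types u : 'rV[R]_m.

Let nR_gt0 : 0 < n%:R :> R.
Proof. by rewrite ltr0n. Qed.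

(** With [t = (k - n) / k] the step turns the determinant into its multiple by
    [1 + t] and costs [t - t ^+ 2] in the linear term, so the decrease is
    [ln (1 + t) - t + t ^+ 2], quadratic in [t].  The step is never
    longer than the exact minimizer [(k - n) / (n k)] along the coordinate. *)
Lemma increase_step u j (k := kappa X u j) (c := (k - n%:R) / k ^+ 2) :
  feasible X u -> n%:R <= k ->
  [/\ 0 <= c, feasible X (u + c *: delta_mx 0 j) &
   objective X (u + c *: delta_mx 0 j) <=
     objective X u - ((k - n%:R) / k) ^+ 2 / 6].
Proof.
move=> [u0 Pu] nk; have k0 : 0 < k := kappa_gt0 Pu (X_neq0 j).
pose t := (k - n%:R) / k.
have t0 : 0 <= t by rewrite divr_ge0 ?subr_ge0 // ltW.
have ck : c * k = t by rewrite /c /t; field; rewrite gt_eqF.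
have c0 : 0 <= c by rewrite divr_ge0 ?subr_ge0 ?sqr_ge0.
have d0 : 0 < 1 + c * k by rewrite ck ltr_wpDr.
split=> //.
  apply: feasible_det => [i|].
    by rewrite !mxE addr_ge0 // mulr_ge0 // ler0n.
  by rewrite det_gram_step // mulr_gt0 ?posdef_det_gt0.
rewrite objective_step // -/k ck.
have := ln1D_ge t0.
have -> : n%:R * c = t - t ^+ 2 by rewrite /c /t; field; rewrite gt_eqF.
rewrite -/t; lra.
Qed.

(** Here [d] is the exact minimizer along the coordinate and [c] the step
    actually made, which the constraint [u >= 0] may shorten.  A shortened step
    still does not increase the objective, but only a full one has a guaranteed
    decrease. *)
Lemma decrease_step u j c (k := kappa X u j) (d := (n%:R - k) / (n%:R * k)) :
  feasible X u -> k <= n%:R -> 0 <= c -> c <= u 0 j -> c <= d ->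
  [/\ feasible X (u - c *: delta_mx 0 j),
      objective X (u - c *: delta_mx 0 j) <= objective X u &
      c = d -> objective X (u - c *: delta_mx 0 j) <=
        objective X u - ((n%:R - k) / n%:R) ^+ 2 / 4].
Proof.
move=> [u0 Pu] kn c0 cu cd; have k0 : 0 < k := kappa_gt0 Pu (X_neq0 j).
have n0 := gt_eqF nR_gt0; have k0' := gt_eqF k0.
have dk : d * k = 1 - k / n%:R by rewrite /d; field; rewrite n0 k0'.
have ck : k / n%:R <= 1 + - c * k.
  have := ler_wpM2r (ltW k0) cd; rewrite dk; lra.
have kn0 : 0 < k / n%:R by rewrite divr_gt0.
have d0 : 0 < 1 + - c * k by apply: lt_le_trans ck.
rewrite -scaleNr; split.
- apply: feasible_det => [i|]; last first.
    by rewrite det_gram_step // mulr_gt0 ?posdef_det_gt0.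
  rewrite !mxE eqxx /=; case: eqVneq => [->|_]; last by rewrite mulr0 addr0.
  by rewrite mulr1 subr_ge0.
- rewrite objective_step // -/k; have := ln_ge_1Binv d0.
  suff : (1 + - c * k)^-1 - 1 <= n%:R * c by lra.
  have -> : (1 + - c * k)^-1 - 1 = c * k / (1 + - c * k).
    by field; move: d0; rewrite mulNr => /gt_eqF->.
  rewrite ler_pdivrMr //.
  have := ler_wpM2l c0 (ler_wpM2l (ltW nR_gt0) ck).
  rewrite [n%:R * (k / _)]mulrC divfK ?n0 //.
  by rewrite mulrA [c * n%:R]mulrC.
- move=> ecd; rewrite objective_step // -/k mulNr ecd dk.
  have -> : 1 + - (1 - k / n%:R) = k / n%:R by ring.
  have k1 : k / n%:R <= 1 by rewrite ler_pdivrMr // mul1r.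
  have := ln_ge kn0 k1.
  have -> : n%:R * - d = 1 - (k / n%:R)^-1 by rewrite /d; field; rewrite n0 k0'.
  have -> : (n%:R - k) / n%:R = 1 - k / n%:R by field; rewrite n0.
  lra.
Qed.

Definition supp u : {set 'I_m} := [set i | 0 < u 0 i].

(** Here [eta] measures how far [u] is from satisfying the optimality
    conditions.  A step that is cut short by [u >= 0] may gain arbitrarily little,
    but it empties a coordinate; any other step fills at most one coordinate
    and gains a multiple of the square of [eta]. *)
Lemma cd_step_progress (K : R) u u' : n%:R <= K -> (forall i, kappa X u i <= K) ->
  feasible X u -> cd_step X u u' ->
  exists eta : R,
    [/\ 0 <= eta,
        forall i, kappa X u i <= n%:R + eta,
        forall i, 0 < u 0 i -> n%:R - eta <= kappa X u i,
        feasible X u' &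
        ((#|supp u'| < #|supp u|)%N /\ objective X u' <= objective X u) \/
        ((#|supp u'| <= #|supp u|.+1)%N /\
         objective X u' <= objective X u - eta ^+ 2 / (6 * K ^+ 2))].
Proof.
move=> nK kK Fu [jp [jm []]]; have [u0 Pu] := Fu.
set kp := kappa X u jp; set km := kappa X u jm => kpP ujm kmP ->.
have K0 : 0 < K by apply: lt_le_trans nK.
case: ifP => [le_mp|/negbT]; last rewrite -ltNge => lt_pm.
  have nkp : n%:R <= kp by have : km <= kp := kpP jm; lra.
  have kp0 : 0 < kp by apply: lt_le_trans nkp.
  have [c0 F' obj'] := increase_step Fu nkp.
  exists (kp - n%:R); split=> //.
  - by rewrite subr_ge0.
  - by move=> i; rewrite addrC subrK; apply: kpP.
  - by move=> i ui; have := kmP i ui; lra.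
  right; split.
    apply: (@leq_trans #|jp |: supp u|); last by rewrite cardsU1; case: (_ \notin _).
    apply: subset_leq_card; apply/fintype.subsetP=> i; rewrite !inE !mxE eqxx /=.
    by case: eqVneq => // _; rewrite mulr0 addr0.
  apply: le_trans obj' _; rewrite lerD2l lerN2.
  have -> : ((kp - n%:R) / kp) ^+ 2 / 6 = (kp - n%:R) ^+ 2 / (6 * kp ^+ 2).
    by field; rewrite gt_eqF.
  rewrite ler_wpM2l ?sqr_ge0 // lef_pV2 ?posrE ?mulr_gt0 ?exprn_gt0 //.
  by rewrite ler_wpM2l // lerXn2r ?nnegrE ?(ltW kp0) ?(ltW K0) ?kK.
have kmn : km <= n%:R by have : km <= kp := kpP jm; lra.
have km0 : 0 < km := kappa_gt0 Pu (X_neq0 jm).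
pose d := (n%:R - km) / (n%:R * km).
have d0 : 0 <= d by rewrite divr_ge0 ?subr_ge0 // mulr_ge0 // ltW.
pose c := Num.min d (u 0 jm).
have -> : \row_i (if i == jm then Num.max (u 0 i - d) 0 else u 0 i) =
    u - c *: delta_mx 0 jm.
  apply/rowP=> i; rewrite !mxE eqxx /=; case: eqVneq => [->|_].
    rewrite /c mulr1; case: (leP d (u 0 jm)) => h.
      by apply/max_idPl; rewrite subr_ge0.
    by rewrite subrr; apply/max_idPr; rewrite subr_le0 ltW.
  by rewrite mulr0 subr0.
have c0 : 0 <= c by rewrite le_min d0 ltW.
have cu : c <= u 0 jm by rewrite ge_min lexx orbT.
have cd : c <= d by rewrite ge_min lexx.
have [F' obj' obj''] := decrease_step Fu kmn c0 cu cd.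
exists (n%:R - km); split=> //.
- by rewrite subr_ge0.
- by move=> i; have := kpP i; rewrite -/kp; lra.
- by move=> i ui; have := kmP i ui; lra.
have sub : supp (u - c *: delta_mx 0 jm) \subset supp u.
  apply/fintype.subsetP=> i; rewrite !inE !mxE eqxx /=; case: eqVneq => [->//|_].
  by rewrite mulr0 subr0.
case: (ltP (u 0 jm) d) => h.
  left; split=> //; rewrite [X in (_ < X)%N](cardsD1 jm) inE ujm ltnS.
  apply: subset_leq_card; rewrite subsetD1 sub inE !mxE !eqxx mulr1 /c.
  by rewrite min_r ?subrr ?ltxx // ltW.
right; split; first by rewrite ltnW // ltnS subset_leq_card.
have /obj'' : c = d by apply/min_idPl.
move=> H; apply: le_trans H _; rewrite lerD2l lerN2.
have -> : ((n%:R - km) / n%:R) ^+ 2 / 4 = (n%:R - km) ^+ 2 / (4 * n%:R ^+ 2).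
  by field; rewrite gt_eqF.
rewrite ler_wpM2l ?sqr_ge0 // lef_pV2 ?posrE ?mulr_gt0 ?exprn_gt0 //.
have : n%:R ^+ 2 <= K ^+ 2 by rewrite lerXn2r ?nnegrE ?(ltW nR_gt0) ?(ltW K0).
have : 0 <= K ^+ 2 by rewrite sqr_ge0.
lra.
Qed.

End Step.

(** * Extrema of continuous functions *)

Section Continuity.
Variables (R : realType) (T : topologicalType).
Implicit Types f g : T -> R.

Lemma continuous_addr f g :
  continuous f -> continuous g -> continuous (fun x => f x + g x).
Proof. by move=> cf cg x; apply: continuousD; [exact: cf|exact: cg]. Qed.

Lemma continuous_oppr f : continuous f -> continuous (fun x => - f x).
Proof. by move=> cf x; apply: continuousN; exact: cf. Qed.

Lemma continuous_mulr f g :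
  continuous f -> continuous g -> continuous (fun x => f x * g x).
Proof. by move=> cf cg x; apply: continuousM; [exact: cf|exact: cg]. Qed.

Lemma continuous_cst (c : R) : continuous (fun _ : T => c).
Proof. exact: cst_continuous. Qed.

Lemma continuous_sumr (I : Type) (r : seq I) (P : pred I) (F : I -> T -> R) :
  (forall i, continuous (F i)) ->
  continuous (fun x => \sum_(i <- r | P i) F i x).
Proof.
move=> cF; elim: r => [|i r IH].
  by under eq_fun do rewrite big_nil; exact: continuous_cst.
by under eq_fun do rewrite big_cons; case: (P i) => //; exact: continuous_addr.
Qed.

Lemma continuous_prodr (I : Type) (r : seq I) (P : pred I) (F : I -> T -> R) :
  (forall i, continuous (F i)) ->
  continuous (fun x => \prod_(i <- r | P i) F i x).
Proof.
move=> cF; elim: r => [|i r IH].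
  by under eq_fun do rewrite big_nil; exact: continuous_cst.
by under eq_fun do rewrite big_cons; case: (P i) => //; exact: continuous_mulr.
Qed.

Lemma continuous_det n (M : T -> 'M[R]_n) :
  (forall i j, continuous (fun x => M x i j)) ->
  continuous (fun x => \det (M x)).
Proof.
move=> cM; apply: continuous_sumr => s.
by apply: continuous_mulr; [exact: continuous_cst|exact: continuous_prodr].
Qed.

End Continuity.

Section Extremum.
Variables (R : realType) (m : nat).
Local Notation V := 'rV[R]_m.

Lemma continuous_linear_form (a : 'I_m -> R) :
  continuous (fun v : V => \sum_i a i * v 0 i).
Proof.
apply: continuous_sumr => i; apply: continuous_mulr; first exact: continuous_cst.
exact: coord_continuous.
Qed.

Lemma continuous_l1norm : continuous (fun v : V => \sum_i `|v 0 i|).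
Proof.
apply: continuous_sumr => i v.
by apply: (@continuous_comp _ _ _ (fun v : V => v 0 i) Num.norm);
  [exact: coord_continuous|exact: norm_continuous].
Qed.

Lemma constrained_min (I : Type) (D : I -> V -> R) (f : V -> R) (M : R) (v0 : V) :
  (forall i, continuous (D i)) -> continuous f ->
  (forall v, (forall i, D i v <= 0) -> forall j, `|v 0 j| <= M) ->
  (forall i, D i v0 <= 0) ->
  exists2 c, forall i, D i c <= 0 & forall v, (forall i, D i v <= 0) -> f c <= f v.
Proof.
move=> cD cf bD Dv0.
pose A := [set v | forall i, D i v <= 0]%classic.
have closedA : closed A.
  have -> : A = (\bigcap_(i in setT) (D i @^-1` [set x | x <= 0]))%classic.
    by apply/seteqP; split=> v /= H i => [_|]; exact: H.
  apply: closed_bigI => i _.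
  by apply: (@preimage_closed _ _ (D i)); [move=> x _; exact: cD|exact: closed_le].
have compactA : compact A.
  apply: (@subclosed_compact _ _
    [set v : V | forall i, `[(- M), M]%classic (v ord0 i)]%classic) => //.
    apply: (@rV_compact R m (fun=> `[(- M), M]%classic)) => i.
    exact: segment_compact.
  by move=> v Av i /=; rewrite in_itv /= -ler_norml; exact: bD.
have A0 : (A !=set0)%classic by exists v0.
have [c cA cmin] := EVT_min_rV A0 compactA (continuous_subspaceT cf).
by exists c => [|v Av]; [rewrite inE in cA|apply: cmin; rewrite inE].
Qed.

End Extremum.

(** * Hoffman's error bound *)

Section Hoffman.
Variables (R : realType) (m : nat).
Implicit Types (u v w z d : 'rV[R]_m) (s : {set 'I_m} * {set 'I_m}).

(** The cones of this form are indexed by a finite type, so that constants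
    obtained for each of them separately combine into one. *)
Definition in_orthant s z :=
  forall i, (i \notin s.1 -> z 0 i <= 0) /\ (i \notin s.2 -> 0 <= z 0 i).

Definition sign_pattern d : {set 'I_m} * {set 'I_m} :=
  ([set i | 0 < d 0 i], [set i | d 0 i < 0]).

Definition conformal z d :=
  forall i, (0 <= z 0 i <= d 0 i) \/ (d 0 i <= z 0 i <= 0).

Lemma in_orthantZ s z (c : R) : 0 <= c -> in_orthant s z -> in_orthant s (c *: z).
Proof.
move=> c0 zs i; have [z1 z2] := zs i; split=> h; rewrite mxE.
  by rewrite mulr_ge0_le0 // z1.
by rewrite mulr_ge0 // z2.
Qed.

Lemma conformal_trans z1 z2 d : conformal z1 z2 -> conformal z2 d -> conformal z1 d.
Proof.
move=> h1 h2 i; case: (h1 i) => /andP[a1 b1]; case: (h2 i) => /andP[a2 b2].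
- by left; lra.
- by right; lra.
- by left; lra.
- by right; lra.
Qed.

Variables (K : finType) (L : K -> 'I_m -> R).
Definition lform k z : R := \sum_i L k i * z 0 i.

Lemma lformD k z1 z2 : lform k (z1 + z2) = lform k z1 + lform k z2.
Proof.
by rewrite -big_split; apply: eq_bigr => i _; rewrite mxE mulrDr.
Qed.

Lemma lformZ k c z : lform k (c *: z) = c * lform k z.
Proof.
by rewrite mulr_sumr; apply: eq_bigr => i _; rewrite mxE mulrCA.
Qed.

Definition orthant_injective s :=
  forall z, in_orthant s z -> (forall k, lform k z = 0) -> z = 0.

(** A ratio test: [z] has the signs of [d] on its support, so moving from [d]
    along [- z] shrinks the entries of [d] until a first one vanishes. *)
Lemma subtract_kernel_vector d z :
  in_orthant (sign_pattern d) z -> z != 0 ->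
  exists t : R, conformal (d - t *: z) d /\
    exists2 i, d 0 i != 0 & (d - t *: z) 0 i = 0.
Proof.
move=> zd /eqP z0.
have [i0 zi0] : exists i, z 0 i != 0.
  apply/existsP; apply: contra_notT z0 => /existsPn z0.
  by apply/rowP=> i; rewrite mxE; apply/eqP; rewrite -[_ == _]negbK.
have dz i : z 0 i != 0 -> 0 < d 0 i / z 0 i.
  have [] := zd i; rewrite !inE -!leNgt => h1 h2 zi.
  have [zp|zn|/eqP] := ltgtP (z 0 i) 0; last by rewrite (negPf zi).
    have dn : d 0 i < 0 by rewrite ltNge; apply/negP => /h2; lra.
    by rewrite nmulr_rgt0 // invr_lt0.
  have dp : 0 < d 0 i by rewrite ltNge; apply/negP => /h1; lra.
  by rewrite divr_gt0.
have := @arg_minP _ R _ i0 (fun i => z 0 i != 0) (fun i => d 0 i / z 0 i) zi0.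
case=> j zj jmin; exists (d 0 j / z 0 j); split; last first.
  exists j; first by have := dz j zj; apply: contraTneq => ->; rewrite mul0r ltxx.
  by rewrite !mxE divfK // subrr.
move=> i; rewrite !mxE; have := dz _ zj; set t := _ / _ => t0.
have [] := zd i; rewrite !inE -!leNgt => h1 h2.
have [zn|zp|->] := ltgtP (z 0 i) 0; last first.
- by rewrite mulr0 subr0; have [|] := lerP 0 (d 0 i); [left|right]; lra.
- have := jmin i (negbT (gt_eqF zp)); rewrite -/t ler_pdivlMr // => td.
  by left; have := mulr_gt0 t0 zp; lra.
- have := jmin i (negbT (lt_eqF zn)); rewrite -/t ler_ndivlMr // => td.
  have tz : t * z 0 i < 0 by rewrite pmulr_rlt0.
  by right; lra.
Qed.

(** Each kernel vector found in the orthant of [d] removes an entry from the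
    support of [d] without changing the values of the forms; when none is left,
    the forms are injective at 0 on the orthant reached. *)
Lemma conformal_reduction d : exists d',
  [/\ conformal d' d, forall k, lform k d' = lform k d &
      orthant_injective (sign_pattern d')].
Proof.
have [p] := ubnP #|[set i | d 0 i != 0]|; elim: p d => // p IH d /ltnSE cd.
have [inj|/existsNP[z /not_implyP[zd /not_implyP[Lz /eqP z0]]]] :=
  pselect (orthant_injective (sign_pattern d)).
  exists d; split=> // i; case: (lerP 0 (d 0 i)) => h; [left|right].
    by rewrite lexx andbT.
  by rewrite lexx ltW.
have [t [cdt [i di dti]]] := subtract_kernel_vector zd z0.
have [|d' [h1 h2 h3]] := IH (d - t *: z).
  apply: leq_trans cd; apply: proper_card; apply/properP; split.
    apply/fintype.subsetP=> j; rewrite !inE; apply: contra_neq => dj.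
    by case: (cdt j); rewrite dj -eq_le eq_sym => /eqP.
  by exists i; rewrite inE ?di // dti eqxx.
exists d'; split=> //; first exact: conformal_trans h1 cdt.
by move=> k; rewrite h2 -scaleNr lformD lformZ Lz mulr0 addr0.
Qed.

(** On the compact set of vectors of norm 1 in the orthant, the sum of the
    absolute values of the forms is continuous and does not vanish, so it has a
    positive minimum; homogeneity does the rest. *)
Lemma orthant_injective_bound s : orthant_injective s ->
  exists2 c : R, 0 <= c & forall z, in_orthant s z ->
    \sum_i `|z 0 i| <= c * \sum_k `|lform k z|.
Proof.
move=> inj.
have n1 z : 0 <= \sum_i `|z 0 i| by apply: sumr_ge0.
have n0 z : \sum_i `|z 0 i| = 0 -> z = 0.
  move=> /psumr_eq0P z0; apply/rowP=> i; rewrite mxE; apply/eqP.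
  by rewrite -normr_eq0 z0.
have l0 z : 0 <= \sum_k `|lform k z| by apply: sumr_ge0.
have [triv|/existsNP[z1 /not_implyP[z1s /eqP z1_neq0]]] :=
    pselect (forall z, in_orthant s z -> z = 0).
  exists 0 => // z /triv ->; rewrite mul0r big1 // => i _.
  by rewrite mxE normr0.
have norm_z z : z != 0 -> 0 < \sum_i `|z 0 i|.
  by move=> z0; rewrite lt_def n1 andbT; apply: contra_neq z0 => /n0.
pose nz z := (\sum_i `|z 0 i|)^-1 *: z.
have nz1 z : z != 0 -> \sum_i `|nz z 0 i| = 1.
  move=> z0; under eq_bigr => i _ do rewrite mxE normrM.
  by rewrite -mulr_sumr ger0_norm ?invr_ge0 // mulVf // gt_eqF // norm_z.
pose D (e : (unit + unit) + ('I_m + 'I_m)) v : R :=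
  match e with
  | inl (inl _) => \sum_i `|v 0 i| - 1
  | inl (inr _) => 1 - \sum_i `|v 0 i|
  | inr (inl i) => if i \in s.1 then 0 else v 0 i
  | inr (inr i) => if i \in s.2 then 0 else - v 0 i
  end.
have DP v : (forall e, D e v <= 0) <-> \sum_i `|v 0 i| = 1 /\ in_orthant s v.
  split=> [H|[v1 vs]].
    have := H (inl (inl tt)); have := H (inl (inr tt)); rewrite /= => h1 h2.
    split; first by lra.
    move=> i; split=> h.
      by have := H (inr (inl i)); rewrite /= (negPf h).
    by have := H (inr (inr i)); rewrite /= (negPf h) oppr_le0.
  move=> [[[]|[]]|[i|i]] /=; rewrite ?v1 ?subrr //; case: ifPn => // h.
    by have [] := vs i => ->.
  by rewrite oppr_le0; have [] := vs i => _ ->.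
have cD e : continuous (D e).
  rewrite /D; case: e => [[[]|[]]|[i|i]].
  - by apply: continuous_addr; [exact: continuous_l1norm|exact: continuous_cst].
  - apply: continuous_addr; first exact: continuous_cst.
    by apply: continuous_oppr; exact: continuous_l1norm.
  - by case: (i \in s.1) => /=; [exact: continuous_cst|exact: coord_continuous].
  - case: (i \in s.2) => /=; first exact: continuous_cst.
    by apply: continuous_oppr; exact: coord_continuous.
have cf : continuous (fun v : 'rV[R]_m => \sum_k `|lform k v|).
  apply: continuous_sumr => k v.
  by apply: (@continuous_comp _ _ _ (lform k) Num.norm);
    [exact: continuous_linear_form|exact: norm_continuous].
have [||c /DP[c1 cs] cmin] := @constrained_min _ _ _ D _ 1 (nz z1) cD cf.
- move=> v /DP[v1 _] j; rewrite -v1 (bigD1 j) //= lerDl.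
  by apply: sumr_ge0.
- by apply/DP; split; [exact: nz1|apply: in_orthantZ; rewrite ?invr_ge0].
set mu := \sum_k _ in cmin.
have mu0 : 0 < mu.
  rewrite lt_def l0 andbT; apply/eqP => /psumr_eq0P mu0.
  have c0 : c = 0.
    by apply: inj => // k; apply/eqP; rewrite -normr_eq0 mu0.
  move: c1; rewrite c0 big1 => [/eqP|i _]; last by rewrite mxE normr0.
  by rewrite eq_sym oner_eq0.
exists mu^-1; first by rewrite invr_ge0 ltW.
move=> z zs; have [->|z0] := eqVneq z 0.
  rewrite big1 ?mulr_ge0 ?invr_ge0 ?(ltW mu0) // => i _.
  by rewrite mxE normr0.
have : mu <= \sum_k `|lform k (nz z)|.
  by apply/cmin/DP; split; [exact: nz1|apply: in_orthantZ; rewrite ?invr_ge0].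
under eq_bigr => k _ do rewrite lformZ normrM.
rewrite -mulr_sumr ger0_norm ?invr_ge0 //.
by rewrite ler_pdivlMl ?norm_z // => h; rewrite ler_pdivlMl // mulrC.
Qed.

(** Hoffman's error bound for a polyhedron in standard form: from [u >= 0] one
    reaches the polyhedron of the nonnegative vectors with the same forms as [v]
    by a move proportional to the residual.  The direct move [v - u] works, but
    its kernel part can be arbitrarily long; removing that part conformally
    keeps the end point between [u] and [v], hence nonnegative, and leaves a
    move controlled by [orthant_injective_bound]. *)
Lemma hoffman_bound : exists2 tau : R, 0 <= tau &
  forall u v, (forall i, 0 <= u 0 i) -> (forall i, 0 <= v 0 i) ->
  exists w, [/\ forall i, 0 <= w 0 i, forall k, lform k w = lform k v &
    \sum_i `|u 0 i - w 0 i| <= tau * \sum_k `|lform k (u - v)|].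
Proof.
have /fin_all_exists[c cP] s : exists c : R, 0 <= c /\
  (orthant_injective s -> forall z, in_orthant s z ->
    \sum_i `|z 0 i| <= c * \sum_k `|lform k z|).
  have [/orthant_injective_bound[c c0 cP]|ninj] := pselect (orthant_injective s).
    by exists c.
  by exists 0.
exists (\sum_s c s); first by apply: sumr_ge0 => s _; have [] := cP s.
move=> u v u0 v0; have [d [dconf Ld inj]] := conformal_reduction (v - u).
exists (u + d); split.
- move=> i; have := dconf i; rewrite !mxE => di.
  by have := u0 i; have := v0 i; case: di => /andP[]; lra.
- by move=> k; rewrite lformD Ld -lformD addrC subrK.
have -> : \sum_i `|u 0 i - (u + d) 0 i| = \sum_i `|d 0 i|.
  by apply: eq_bigr => i _; rewrite mxE opprD addNKr normrN.
have -> : \sum_k `|lform k (u - v)| = \sum_k `|lform k d|.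
  apply: eq_bigr => k _; rewrite Ld -opprB -scaleN1r lformZ mulN1r.
  by rewrite normrN.
have ds : in_orthant (sign_pattern d) d.
  by move=> i; rewrite !inE -!leNgt.
have [_ /(_ inj d ds) h] := cP (sign_pattern d).
apply: le_trans h _; apply: ler_wpM2r; first exact: sumr_ge0.
rewrite (bigD1 (sign_pattern d)) //= lerDl; apply: sumr_ge0 => s _.
by have [] := cP s.
Qed.

End Hoffman.

(** * The minimum and the quadratic error bound *)

Section Optimum.
Variables (R : realType) (n m : nat) (X : 'M[R]_(n, m)).
Hypothesis n_gt0 : (0 < n)%N.
Hypothesis X_neq0 : forall i, col i X != 0.
Implicit Types u v w : 'rV[R]_m.

Let nR_gt0 : 0 < n%:R :> R.
Proof. by rewrite ltr0n. Qed.

Lemma feasible_scale u c : 0 < c -> feasible X u -> feasible X (c *: u).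
Proof.
move=> c0 [u0 Pu]; apply: feasible_det => [i|].
  by rewrite mxE mulr_ge0 // ltW.
by rewrite gramZ detZ mulr_gt0 ?exprn_gt0 ?posdef_det_gt0.
Qed.

Lemma kappa_scale u c i : 0 < c -> posdefmx (gram X u) ->
  kappa X (c *: u) i = c^-1 * kappa X u i.
Proof.
move=> c0 Pu; have uc : c \is a GRing.unit by rewrite unitfE gt_eqF.
have uZ : c *: gram X u \in unitmx by rewrite unitmxZ // posdef_unitmx.
by rewrite /kappa gramZ invmxZ // -scalemxAr -scalemxAl mxE.
Qed.

Lemma sum_scale u c : \sum_i (c *: u) 0 i = c * \sum_i u 0 i.
Proof. by rewrite mulr_sumr; apply: eq_bigr => i _; rewrite mxE. Qed.

Lemma feasible_sum_gt0 u : feasible X u -> 0 < \sum_i u 0 i.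
Proof.
move=> [u0 Pu]; rewrite lt_def sumr_ge0 // andbT.
apply: contraTneq nR_gt0 => /psumr_eq0P z.
by rewrite -(sum_kappa Pu) big1 ?ltxx // => i _; rewrite z ?mul0r.
Qed.

Lemma objective_scale u c : 0 < c -> feasible X u ->
  objective X (c *: u) =
  objective X u - n%:R * ln c + n%:R * ((c - 1) * \sum_i u 0 i).
Proof.
move=> c0 [u0 Pu]; rewrite /objective gramZ detZ sum_scale.
rewrite lnM ?posrE ?exprn_gt0 ?posdef_det_gt0 // lnXn // -mulr_natl.
ring.
Qed.

(** The tangent of the log-determinant at [c *: u0] has the slopes
    [kappa X u0 i / c].  For [c] large they are at most [n / 2], half the slope
    of the linear term of the objective. *)
Lemma objective_coercive u0 : feasible X u0 -> exists C : R,
  forall u, feasible X u -> n%:R / 2 * \sum_i u 0 i <= objective X u + C.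
Proof.
move=> F0; have [u00 Pu0] := F0.
(* This c makes every kappa X u0 i at most c * n / 2; the summand 1 keeps it
   positive. *)
pose c := 2 / n%:R * (\sum_i kappa X u0 i) + 1.
have k0 i : 0 <= kappa X u0 i by rewrite ltW // kappa_gt0.
have s0 : 0 <= \sum_i kappa X u0 i by rewrite sumr_ge0.
have c0 : 0 < c by rewrite ltr_wpDl // mulr_ge0 // divr_ge0 // ltW.
have [_ Pv] := feasible_scale c0 F0.
exists (ln (\det (gram X (c *: u0)))) => u [pu Pu].
have := ln_det_concave Pv Pu; rewrite trace_kappa.
have : \sum_i u 0 i * kappa X (c *: u0) i <= n%:R / 2 * \sum_i u 0 i.
  rewrite mulr_sumr; apply: ler_sum => i _; rewrite mulrC ler_wpM2r //.
  rewrite kappa_scale // ler_pdivrMl // /c mulrDl mul1r.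
  have -> : 2 / n%:R * (\sum_i kappa X u0 i) * (n%:R / 2) = \sum_i kappa X u0 i.
    by field; rewrite gt_eqF.
  rewrite (bigD1 i) //= -addrA lerDl addr_ge0 ?sumr_ge0 //.
  by rewrite divr_ge0 // ltW.
rewrite /objective; lra.
Qed.

Lemma det_exp_objective v : feasible X v ->
  \det (gram X v) * expR (- n%:R * \sum_i v 0 i) = expR (- objective X v - n%:R).
Proof.
move=> [_ Pv]; rewrite -{1}[\det _]lnK ?posrE ?posdef_det_gt0 // -expRD.
by congr expR; rewrite /objective; ring.
Qed.

(** The objective is not continuous where the Gram matrix degenerates; the
    determinant times the exponential of the linear term is, and maximizing it
    on a simplex that contains the level set of [u0] is the same problem. *)
Lemma exists_minimizer u0 : feasible X u0 ->
  exists2 us, feasible X us & forall v, feasible X v -> objective X us <= objective X v.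
Proof.
move=> F0; have [C coer] := objective_coercive F0.
have hn : 0 < n%:R / 2 :> R by rewrite divr_gt0.
pose S := (objective X u0 + C) / (n%:R / 2).
pose f v := - (\det (gram X v) * expR (- n%:R * \sum_i v 0 i)).
pose D (e : 'I_m + unit) v : R :=
  match e with inl i => - v 0 i | inr _ => \sum_i v 0 i - S end.
have DP v : (forall e, D e v <= 0) <-> (forall i, 0 <= v 0 i) /\ \sum_i v 0 i <= S.
  split=> [H|[v0 vS]].
    split=> [i|]; first by have := H (inl i); rewrite /= oppr_le0.
    by have := H (inr tt); rewrite /= subr_le0.
  by case=> [i|[]] /=; rewrite ?oppr_le0 ?subr_le0.
have cS : continuous (fun v : 'rV[R]_m => \sum_i v 0 i).
  by apply: continuous_sumr => i; exact: coord_continuous.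
have cD e : continuous (D e).
  rewrite /D; case: e => [i|e].
    by apply: continuous_oppr; exact: coord_continuous.
  by apply: continuous_addr; [exact: cS|exact: continuous_cst].
have cf : continuous f.
  apply: continuous_oppr; apply: continuous_mulr.
    apply: continuous_det => a b.
    under [X in continuous X]eq_fun => w do rewrite gramE.
    apply: continuous_sumr => i; apply: continuous_mulr; last exact: continuous_cst.
    exact: coord_continuous.
  move=> v; apply: (@continuous_comp _ _ _
    (fun v : 'rV[R]_m => - n%:R * \sum_i v 0 i) expR); last exact: continuous_expR.
  exact: (continuous_mulr (@continuous_cst _ _ _) cS).
have bD v : (forall e, D e v <= 0) -> forall j, `|v 0 j| <= S.
  move=> /DP[v0 vS] j; rewrite ger0_norm //; apply: le_trans vS.
  by rewrite (bigD1 j) //= lerDl sumr_ge0.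
have fE v : feasible X v -> f v = - expR (- objective X v - n%:R).
  by move=> Fv; rewrite /f det_exp_objective.
have D0 : forall e, D e u0 <= 0.
  apply/DP; split; first by case: F0.
  by rewrite ler_pdivlMr // mulrC; exact: coer.
have [us /DP[us0 _] usmin] := constrained_min cD cf bD D0.
have Fus : feasible X us.
  apply: feasible_det => //.
  have := usmin _ D0; rewrite (fE _ F0) /f lerN2 => h.
  by have := lt_le_trans (expR_gt0 _) h; rewrite pmulr_lgt0 ?expR_gt0.
have le_us v : (forall i, 0 <= v 0 i) -> \sum_i v 0 i <= S -> feasible X v ->
    objective X us <= objective X v.
  move=> v0 vS Fv; have := usmin v; rewrite (fE _ Fv) (fE _ Fus) lerN2 ler_expR.
  by move=> h; have := h ((DP v).2 (conj v0 vS)); lra.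
exists us => // v Fv; have [vS|Sv] := lerP (\sum_i v 0 i) S.
  by apply: le_us => //; case: Fv.
have [u00 uS] := (DP u0).1 D0.
apply: (le_trans (le_us u0 u00 uS F0)).
have := coer _ Fv; move: Sv; rewrite /S ltr_pdivrMr // mulrC; lra.
Qed.

Section Minimizer.
Variable us : 'rV[R]_m.
Hypothesis us_feasible : feasible X us.
Hypothesis us_min : forall v, feasible X v -> objective X us <= objective X v.

(** Otherwise the increase step of the algorithm would improve on the
    minimizer. *)
Lemma minimizer_kappa_le i : kappa X us i <= n%:R.
Proof.
rewrite leNgt; apply/negP => ki.
have [_ F' obj'] := increase_step X_neq0 us_feasible (ltW ki).
have := le_trans (us_min F') obj'.
have : 0 < ((kappa X us i - n%:R) / kappa X us i) ^+ 2 / 6.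
  rewrite divr_gt0 // exprn_gt0 // divr_gt0 ?subr_gt0 //.
  by apply: lt_trans ki.
lra.
Qed.

(** Rescaling the minimizer to total weight 1 must not improve it, which is
    [s - 1 <= ln s] for the total weight [s]. *)
Lemma minimizer_sum : \sum_i us 0 i = 1.
Proof.
have s0 := feasible_sum_gt0 us_feasible; set s := \sum_i _ in s0 *.
have si : 0 < s^-1 by rewrite invr_gt0.
have := us_min (feasible_scale si us_feasible).
rewrite objective_scale // -/s mulrBl mul1r mulVf ?gt_eqF // lnV ?posrE //.
rewrite -addrA lerDl -mulrN opprK -mulrDr pmulr_rge0 // => h.
have [ls|ls] := eqVneq (ln s) 0; first by rewrite -(lnK s0) ls expR0.
by have := expR_gt1Dx ls; rewrite lnK ?posrE //; lra.
Qed.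

(** A unit of weight added at coordinate [i] changes the objective by
    [n - ln (1 + kappa X u i)], and the result stays above the minimum. *)
Lemma kappa_bounded h0 : exists K : R, n%:R <= K /\
  forall u, feasible X u -> objective X u <= h0 -> forall i, kappa X u i <= K.
Proof.
pose K := expR (h0 - objective X us + n%:R).
exists (n%:R + K); split; first by rewrite lerDl expR_ge0.
move=> u [u0 Pu] uh i; have k0 := kappa_gt0 Pu (X_neq0 i).
have d0 : 0 < 1 + 1 * kappa X u i by rewrite mul1r addr_gt0.
have F' : feasible X (u + 1 *: delta_mx 0 i).
  apply: feasible_det => [j|].
    by rewrite !mxE addr_ge0 // mulr_ge0 // ler0n.
  by rewrite det_gram_step // mulr_gt0 ?posdef_det_gt0.
have := us_min F'; rewrite objective_step // mulr1 => h.
have : 1 + 1 * kappa X u i <= K.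
  by rewrite -(@lnK _ (1 + _)) ?posrE // ler_expR; lra.
rewrite mul1r; have := nR_gt0; lra.
Qed.

(** The gap to the minimum is at most quadratic in the violation [eta] of the
    optimality conditions.  By convexity the gap is at most [eta * d], where [d]
    is the distance from [u] to any minimizer [w], so it suffices to find [w]
    with [d] of order [eta].

    The minimizers form a polyhedron: the nonnegative [w] with the Gram matrix
    of [us] and with [\sum_i c i * w i = 0], where [c i] is the slack
    [n - kappa X us i].  Hoffman's bound provides [w] with [d <= tau * (a + g)],
    where [a] is the distance between Gram matrices and [g] is
    [\sum_i c i * u i].  The pairing [slope] of the gradient at [u] with [u - w]
    is at most [eta * d], and it splits into [T + g], where [T] dominates the
    square of [a] by [gram_dist_le].  If [tau * eta] is at most one half, [g] is
    absorbed and [d ^+ 2] is of order [eta * d].  Otherwise [eta] is bounded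
    below, and the boundedness of the level set suffices. *)
Lemma error_bound h0 : exists2 C : R, 0 < C &
  forall u eta, feasible X u -> objective X u <= h0 -> 0 <= eta ->
  (forall i, kappa X u i <= n%:R + eta) ->
  (forall i, 0 < u 0 i -> n%:R - eta <= kappa X u i) ->
  objective X u - objective X us <= C * eta ^+ 2.
Proof.
pose c i := n%:R - kappa X us i.
have c0 i : 0 <= c i by rewrite subr_ge0 minimizer_kappa_le.
(* One form for each entry of the Gram matrix, and one for the total slack. *)
pose L (k : 'I_n * 'I_n + 'I_1) i :=
  match k with inl ab => X ab.1 i * X ab.2 i | inr _ => c i end.
have lform_gram ab v : lform L (inl ab) v = gram X v ab.1 ab.2.
  by rewrite gramE; apply: eq_bigr => i _; rewrite mulrC.
have [tau tau0 hof] := hoffman_bound L.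
have [C0 coer] := objective_coercive us_feasible.
pose S := (h0 + C0) / (n%:R / 2).
have hn : 0 < n%:R / 2 :> R by rewrite divr_gt0.
pose B := \sum_a \sum_i X a i ^+ 2.
have B0 : 0 <= B.
  by rewrite sumr_ge0 // => a _; rewrite sumr_ge0 // => i _; rewrite sqr_ge0.
have BX a i : X a i ^+ 2 <= B.
  rewrite /B (bigD1 a) //= (bigD1 i) //= -addrA lerDl.
  rewrite addr_ge0 ?sumr_ge0 // => *; rewrite ?sqr_ge0 ?sumr_ge0 // => *.
  by rewrite sqr_ge0.
pose C1 := n%:R ^+ 4 * (B * B * `|S|).
have C10 : 0 <= C1 by rewrite mulr_ge0 ?exprn_ge0 // ?mulr_ge0 // ltW.
pose C := 4 * tau ^+ 2 * C1 + 2 * tau * (`|S| + 1) + 1.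
have Cp : 0 < C.
  by rewrite ltr_wpDl // addr_ge0 // !mulr_ge0 // ?exprn_ge0 // addr_ge0.
exists C => // u eta Fu uh eta0 kle kge.
have [u0 Pu] := Fu; have [us0 Pus] := us_feasible.
have uS : \sum_i u 0 i <= `|S|.
  apply: le_trans (ler_norm _); rewrite ler_pdivlMr // mulrC.
  by apply: le_trans (coer _ Fu) _; rewrite lerD2r.
have [w [w0 Lw dist_w]] := hof u us u0 us0.
have gw : gram X w = gram X us.
  by apply/matrixP=> a b; rewrite -(lform_gram (a, b)) Lw lform_gram.
have kw i : kappa X w i = kappa X us i by rewrite /kappa gw.
have Fw : feasible X w by split; rewrite ?gw.
have Pw := Fw.2.
have lnone v : lform L (inr 0) v = n%:R * (\sum_i v 0 i) - \sum_i v 0 i * kappa X us i.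
  rewrite mulr_sumr -sumrB; apply: eq_bigr => i _; rewrite /= /c; ring.
have lus : lform L (inr 0) us = 0.
  by rewrite lnone minimizer_sum mulr1 sum_kappa // subrr.
have lw : lform L (inr 0) w = 0 by rewrite Lw.
(* The total slack of w is n times its weight, minus a trace that its Gram matrix
   forces to be n. *)
have sw : \sum_i w 0 i = 1.
  have := lw; rewrite lnone; under [X in _ - X]eq_bigr => i _ do rewrite -kw.
  rewrite sum_kappa // => h; apply: (mulfI (lt0r_neq0 nR_gt0)).
  by rewrite mulr1; apply/eqP; rewrite -subr_eq0 h.
have ow : objective X w = objective X us by rewrite /objective gw sw minimizer_sum.
set d := \sum_i `|u 0 i - w 0 i| in dist_w.
pose slope := \sum_i (n%:R - kappa X u i) * (u 0 i - w 0 i).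
(* Where u vanishes, only the upper bound on kappa is available, and it suffices
   because u - w is nonpositive there. *)
have slope_le : slope <= eta * d.
  rewrite /d mulr_sumr; apply: ler_sum => i _.
  have := u0 i; rewrite le_eqVlt => /predU1P[ui|ui].
    rewrite -ui sub0r normrN ger0_norm // mulrN -mulNr ler_wpM2r //.
    by have := kle i; lra.
  apply: le_trans (ler_norm _) _; rewrite normrM ler_wpM2r //.
  by rewrite ler_norml; have := kle i; have := kge i ui; lra.
have obj_le : objective X u - objective X us <= eta * d.
  by rewrite -ow; apply: le_trans (objective_gradient Pu Pw) slope_le.
pose g := \sum_i c i * u 0 i.
have g0 : 0 <= g by rewrite sumr_ge0 // => i _; rewrite mulr_ge0.
pose T := \sum_i (kappa X w i - kappa X u i) * (u 0 i - w 0 i).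
have Tg : T + g = slope.
  rewrite -[g]subr0 -lw /lform /T -sumrB -big_split /slope; apply: eq_bigr => i _ /=.
  rewrite kw /c; ring.
pose a := \sum_ab `|(gram X u - gram X us) ab.1 ab.2|.
have a0 : 0 <= a by rewrite sumr_ge0.
have resE : \sum_k `|lform L k (u - us)| = a + g.
  rewrite big_sumType /= big_ord1; congr (_ + _).
    apply: eq_bigr => ab _; rewrite -scaleN1r lformD lformZ !lform_gram mulN1r.
    by rewrite !mxE.
  by rewrite -scaleN1r lformD lformZ lus mulr0 addr0 ger0_norm.
rewrite resE in dist_w.
have d0 : 0 <= d by rewrite sumr_ge0.
(* The gradient is monotone: add the two tangent inequalities. *)
have T0 : 0 <= T.
  have h1 := objective_gradient Pu Pw; have h2 := objective_gradient Pw Pu.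
  have : T = slope + \sum_i (n%:R - kappa X w i) * (w 0 i - u 0 i).
    rewrite /slope -big_split; apply: eq_bigr => i _ /=; ring.
  by rewrite -/slope in h1; lra.
have entry_le x y : (gram X u - gram X us) x y ^+ 2 <= B * B * `|S| * T.
  have wB v z : (forall i, 0 <= v 0 i) ->
      \sum_i v 0 i * X z i ^+ 2 <= (\sum_i v 0 i) * B.
    by move=> v0; rewrite mulr_suml; apply: ler_sum => i _; rewrite ler_wpM2l.
  have pos v z : (forall i, 0 <= v 0 i) -> 0 <= \sum_i v 0 i * X z i ^+ 2.
    by move=> v0; rewrite sumr_ge0 // => i _; rewrite mulr_ge0 ?sqr_ge0.
  rewrite -gw; apply: le_trans (gram_dist_le _ _ Fu Fw) _; apply: ler_wpM2r => //.
  have -> : B * B * `|S| = (`|S| * B) * B by ring.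
  apply: ler_pM; rewrite ?pos //.
    by apply: le_trans (wB _ _ u0) _; rewrite ler_wpM2r.
  by apply: le_trans (wB _ _ w0) _; rewrite sw mul1r.
have aT : a ^+ 2 <= C1 * T.
  pose D (k : 'I_n * 'I_n) := (gram X u - gram X us) k.1 k.2.
  have := weighted_cauchy_schwarz (fun k => `|D k|) (fun=> 1) (fun=> ler01).
  under eq_bigr => k _ do rewrite mul1r mulr1.
  rewrite -/a => /le_trans; apply.
  have -> : \sum_(k : 'I_n * 'I_n) (1 * 1 ^+ 2 : R) = n%:R ^+ 2.
    under eq_bigr => k _ do rewrite mul1r expr1n.
    by rewrite sumr_const card_prod card_ord natrM expr2.
  rewrite /C1 (_ : n%:R ^+ 4 * _ * T = n%:R ^+ 2 * (n%:R ^+ 2 * (B * B * `|S| * T)));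
    last by ring.
  rewrite ler_wpM2l ?exprn_ge0 ?(ltW nR_gt0) //.
  have -> : n%:R ^+ 2 * (B * B * `|S| * T) =
      \sum_(k : 'I_n * 'I_n) (B * B * `|S| * T).
    by rewrite sumr_const card_prod card_ord -[RHS]mulr_natl natrM expr2.
  by apply: ler_sum => k _; rewrite mul1r real_normK ?num_real // entry_le.
have dC : d <= C * eta.
  have [te|te] := lerP (tau * eta) (1 / 2).
    have d2a : d <= 2 * tau * a.
      have : tau * g <= d / 2.
        have : tau * g <= tau * (eta * d) by rewrite ler_wpM2l //; lra.
        have : tau * eta * d <= 1 / 2 * d by rewrite ler_wpM2r.
        lra.
      lra.
    have [->|d_neq0] := eqVneq d 0; first by rewrite mulr_ge0 // ltW.
    have d_gt0 : 0 < d by rewrite lt_def d_neq0.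
    have : d * d <= 4 * tau ^+ 2 * C1 * eta * d.
      apply: (@le_trans _ _ ((2 * tau * a) ^+ 2)).
        by rewrite expr2 ler_pM.
      have -> : (2 * tau * a) ^+ 2 = 4 * tau ^+ 2 * a ^+ 2 by ring.
      have -> : 4 * tau ^+ 2 * C1 * eta * d = 4 * tau ^+ 2 * (C1 * (eta * d)).
        by ring.
      rewrite ler_wpM2l ?mulr_ge0 ?sqr_ge0 //.
      apply: (le_trans aT); rewrite ler_wpM2l //; lra.
    rewrite ler_pM2r // => /le_trans; apply; rewrite ler_wpM2r //.
    rewrite /C -addrA lerDl addr_ge0 // mulr_ge0 ?mulr_ge0 //.
    by rewrite addr_ge0.
  apply: (@le_trans _ _ (`|S| + 1)).
    apply: (@le_trans _ _ (\sum_i (u 0 i + w 0 i))).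
      apply: ler_sum => i _; apply: le_trans (ler_normB _ _) _.
      by rewrite !ger0_norm.
    by rewrite big_split /= sw lerD2r.
  have : 1 * (`|S| + 1) <= 2 * (tau * eta) * (`|S| + 1).
    by rewrite ler_wpM2r ?addr_ge0 //; lra.
  rewrite mul1r => /le_trans; apply.
  have -> : 2 * (tau * eta) * (`|S| + 1) = 2 * tau * (`|S| + 1) * eta by ring.
  rewrite ler_wpM2r // /C [in leRHS]addrAC lerDr addr_ge0 //.
  by rewrite !mulr_ge0 ?sqr_ge0.
apply: le_trans obj_le _; rewrite expr2 mulrCA; exact: ler_wpM2l.
Qed.

End Minimizer.
End Optimum.

(** * Counting the iterations *)

Section Counting.
Variables (R : realType) (c C : R) (h e : nat -> R) (s : nat -> nat).
Hypothesis (c_gt0 : 0 < c) (C_gt0 : 0 < C).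
Hypothesis h_ge0 : forall k, 0 <= h k.
Hypothesis h_le : forall k, h k <= C * e k ^+ 2.
Hypothesis progress : forall k,
  ((s k.+1 < s k)%N /\ h k.+1 <= h k) \/
  ((s k.+1 <= (s k).+1)%N /\ h k.+1 <= h k - c * e k ^+ 2).

Let b := c / C.

(** The progress of a productive step is proportional to the square of the
    violation, which bounds the gap; hence the gap shrinks by a factor. *)
Lemma contraction k : h k - c * e k ^+ 2 <= expR (- b) * h k.
Proof.
have : (1 + - b) * h k <= expR (- b) * h k by rewrite ler_wpM2r ?expR_ge1Dx.
apply: le_trans; rewrite mulrDl mul1r mulNr lerD2l lerN2 /b mulrAC ler_pdivrMr //.
by rewrite -mulrA ler_wpM2l 1?mulrC // ltW.
Qed.

(** Call a step productive if it is of the second kind in [progress], and let [p]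
    be the number of productive ones among the first [N].  An unproductive step
    lowers [s] and a productive one raises it by at most 1, hence the first
    inequality.  The last one holds because the latest productive step gained at
    least [c * eps ^+ 2], which cannot exceed the gap left by the preceding ones;
    for [p = 0] it follows from [c <= H]. *)
Lemma count_productive (H eps : R) (N : nat) :
  h 0 <= H -> c <= H -> 0 < eps -> eps <= 1 ->
  (forall k, (k < N)%N -> eps < e k) ->
  exists p : nat, [/\ (N + s N <= 2 * p + s 0)%N, h N <= expR (- b * p%:R) * H &
    c * eps ^+ 2 <= expR (b - b * p%:R) * H].
Proof.
move=> h0H cH eps0 eps1.
have b0 : 0 <= b by rewrite divr_ge0 // ltW.
elim: N => [_|N IH eN].
  exists 0%N; rewrite !mulr0 expR0 mul1r subr0; split=> //.
  have c1 : c * eps ^+ 2 <= c by rewrite ger_pMr // exprn_ile1 // ltW.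
  have e1 : 1 <= expR b by rewrite -expR0 ler_expR.
  apply: (le_trans c1); apply: (le_trans cH).
  by rewrite ler_peMl // (le_trans _ cH) // ltW.
have [|p [sN hN ceps]] := IH; first by move=> k kN; apply: eN; exact: ltnW.
case: (progress N) => -[sS hS].
  exists p; split=> //; last by apply: le_trans hS hN.
  by apply: leq_trans sN; rewrite addSnnS leq_add2l.
have eq1 : expR (- b * p.+1%:R) = expR (- b) * expR (- b * p%:R).
  by rewrite -expRD; congr expR; rewrite -natr1; ring.
have eq2 : expR (b - b * p.+1%:R) = expR (- b * p%:R).
  by congr expR; rewrite -natr1; ring.
exists p.+1; rewrite eq1 eq2; split.
- apply: (@leq_trans (N.+1 + (s N).+1)); first by rewrite leq_add2l.
  by rewrite mulnS addSn addnS -addnA add2n !ltnS.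
- apply: (le_trans hS); apply: (le_trans (contraction N)).
  by rewrite -mulrA ler_wpM2l ?expR_ge0.
- apply: le_trans hN; apply: (@le_trans _ _ (c * e N ^+ 2)).
    have := eN N (leqnn _) => he.
    by rewrite ler_wpM2l ?(ltW c_gt0) // lerXn2r ?nnegrE ?ltW // (lt_trans eps0).
  by have := h_ge0 N.+1; lra.
Qed.

Lemma iterations_bound (H eps : R) (N : nat) :
  h 0 <= H -> c <= H -> 0 < eps -> eps <= 1 ->
  (forall k, (k < N)%N -> eps < e k) ->
  N%:R <= (2 * (1 + (ln H - ln c) / b) + (s 0)%:R)
          + 4 * ln 2 / b * log2 (1 / eps).
Proof.
move=> h0H cH eps0 eps1 eN.
have [p [sN _ ceps]] := count_productive h0H cH eps0 eps1 eN.
have b0 : 0 < b by rewrite divr_gt0.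
have H0 : 0 < H by apply: lt_le_trans cH.
have Np : N%:R <= 2 * p%:R + (s 0)%:R :> R.
  rewrite -natrM -natrD ler_nat; apply: leq_trans sN; exact: leq_addr.
have ln2 : 0 < ln 2 :> R by rewrite ln_gt0 // ltr1n.
have -> : 4 * ln 2 / b * log2 (1 / eps) = 2 * (2 * ln (1 / eps) / b).
  rewrite /log2; field; rewrite !gt_eqF //.
rewrite div1r lnV ?posrE //.
move: ceps; rewrite -ler_ln ?posrE ?mulr_gt0 ?exprn_gt0 ?expR_gt0 //.
rewrite expr2 !lnM ?posrE ?mulr_gt0 ?expR_gt0 // expRK => ceps.
have : p%:R <= 1 + (ln H - ln c) / b + 2 * - ln eps / b.
  rewrite -(ler_pM2l b0).
  have -> : b * (1 + (ln H - ln c) / b + 2 * - ln eps / b) =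
     b + (ln H - ln c) + 2 * - ln eps by field; rewrite gt_eqF.
  lra.
lra.
Qed.

End Counting.

(** Otherwise the segment of all indices up to [B] avoids [P], and it is longer
    than [B]. *)
Lemma exists_le_of_unmet_bound (R : realType) (P : nat -> Prop) (B : R) :
  (forall N : nat, (forall k, (k < N)%N -> ~ P k) -> N%:R <= B) ->
  exists k : nat, k%:R <= B /\ P k.
Proof.
move=> H; apply: contrapT => /forallNP nP.
have B0 : 0 <= B by apply: (H 0%N).
have /andP[tB Bt] := truncn_itv B0.
have : (Num.truncn B).+1%:R <= B.
  apply: H => k; rewrite ltnS => kt Pk; apply: (nP k); split=> //.
  by apply: le_trans tB; rewrite ler_nat.
by rewrite leNgt Bt.
Qed.

(** * Linear convergence of the algorithm *)

Section Run.
Variables (R : realType) (n m : nat) (X : 'M[R]_(n, m)).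
Hypothesis X_neq0 : forall i, col i X != 0.

(** In both schemes the points of positive weight span the space. *)
Lemma initial_feasible (u0 : 'rV[R]_m) :
  points_span X (fun _ => true) ->
  khachiyan_init u0 \/ kumar_yildirim_init X u0 -> feasible X u0.
Proof.
move=> span [->|[u00 _ _ us _]]; last by split=> //; exact: span_posdef.
have u_gt0 i : 0 < (const_mx m%:R^-1 : 'rV[R]_m) 0 i.
  by rewrite mxE invr_gt0 ltr0n; case: (m) i => [[]|].
split=> [i|]; first exact: ltW.
apply: span_posdef => [i|]; first exact: ltW.
rewrite /points_span (eq_bigl xpredT) // => i; exact: u_gt0.
Qed.

Lemma cd_run_iterations (u0 : 'rV[R]_m) : (0 < n)%N -> feasible X u0 ->
  exists P Q : R, forall eps : R, 0 < eps -> eps < 1 ->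
    forall u : nat -> 'rV[R]_m, cd_run X u0 u ->
      exists k : nat, k%:R <= P + Q * log2 (1 / eps) /\ approx_optimal X eps (u k).
Proof.
move=> n0 F0; have [us Fus usmin] := exists_minimizer n0 X_neq0 F0.
have [K [nK kK]] := kappa_bounded n0 X_neq0 usmin (objective X u0).
have [C C0 err] := error_bound n0 X_neq0 Fus usmin (objective X u0).
have K0 : 0 < K by apply: lt_le_trans nK; rewrite ltr0n.
pose c := (6 * K ^+ 2)^-1.
have c0 : 0 < c by rewrite invr_gt0 mulr_gt0 ?exprn_gt0.
(* The gap at u0 would do, but for the inequality c <= H. *)
pose H := objective X u0 - objective X us + c.
exists (2 * (1 + (ln H - ln c) / (c / C)) + #|supp u0|%:R), (4 * ln 2 / (c / C)).
move=> eps eps0 eps1 u [u0E ustep].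
have [Fu hu] : (forall k, feasible X (u k)) /\
    (forall k, objective X (u k) <= objective X u0).
  have FU k : feasible X (u k) /\ objective X (u k) <= objective X u0.
    elim: k => [|k [Fk hk]]; first by rewrite u0E.
    have [eta [_ _ _ F' [[_ h']|[_ h']]]] :=
      cd_step_progress n0 X_neq0 nK (kK _ Fk hk) Fk (ustep k).
      by split=> //; apply: le_trans hk.
    split=> //; apply: le_trans hk; apply: le_trans h' _.
    by rewrite gerBl divr_ge0 ?sqr_ge0 // mulr_ge0 ?sqr_ge0.
  by split=> k; have [] := FU k.
have /choice[e eP] k :=
  cd_step_progress n0 X_neq0 nK (kK _ (Fu k) (hu k)) (Fu k) (ustep k).
apply: exists_le_of_unmet_bound => N notopt.
rewrite -u0E.
apply: (@iterations_bound _ c C (fun k => objective X (u k) - objective X us) e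
  (fun k => #|supp (u k)|) c0 C0) => //.
- by move=> k; rewrite subr_ge0 usmin.
- by move=> k; have [e0 ek1 ek2 _ _] := eP k; apply: err.
- move=> k; have [_ _ _ _ [[sk hk]|[sk hk]]] := eP k; [left|right]; split=> //.
    by rewrite lerD2r.
  by move: hk; rewrite mulrC -/c; lra.
- by rewrite u0E lerDl ltW.
- by rewrite lerDr subr_ge0 usmin.
- exact: ltW.
move=> k kN; rewrite ltNge; apply/negP => ek; apply: (notopt k kN).
have [e0 ek1 ek2 _ _] := eP k; have [uk Pk] := Fu k.
have epsn : eps <= eps * n%:R by rewrite ler_peMr ?(ltW eps0) // ler1n.
split=> // i; rewrite mulrDl mul1r; first by have := ek1 i; lra.
by move=> /ek2; rewrite mulNr; lra.
Qed.

End Run.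

Theorem theorem3 (R : realType) (n m : nat) (X : 'M[R]_(n, m))
    (hX0 : forall i : 'I_m, col i X != 0)
    (hXspan : points_span X (fun _ => true))
    (u0 : 'rV[R]_m)
    (hu0 : khachiyan_init u0 \/ kumar_yildirim_init X u0) :
  exists P Q : R,
    forall eps : R, 0 < eps -> eps < 1 ->
    forall u : nat -> 'rV[R]_m, cd_run X u0 u ->
      exists k : nat,
        k%:R <= P + Q * log2 (1 / eps) /\ approx_optimal X eps (u k).
Proof.
have F0 := initial_feasible hXspan hu0.
case: n X hX0 F0 {hXspan hu0} => [|n'] X hX0 F0; last exact: cd_run_iterations.
(* In dimension 0 every point is the zero vector, so there are no points and no
   step is possible. *)
exists 0, 0 => eps _ _ u [_ /(_ 0%N)[j _]].
by have /eqP[] := hX0 j; apply/matrixP => -[].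
Qed.
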